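(* Let $\overline{a}=(a_1,\dots,a_\ell)$ be a weak composition of $n$ (nonnegative integers with sum $n$) and let $P_{\overline{a}}$ be the disjoint union of chains of sizes $a_1,\dots,a_\ell$, with the standardized labeling. There is a bijection $\mathcal{L}(P_{\overline{a}})\to\mathfrak{S}^{\pitchfork}(P_{\overline{a}})$, $\sigma\mapsto\tau$, with $\operatorname{cyc}(\tau)=\operatorname{fc}(\sigma)$. Consequently \[ {\sf Poin}(P_{\overline{a}},t)=\sum_{\sigma\in\mathcal{L}(P_{\overline{a}})} t^{\,n-\operatorname{fc}(\sigma)}. \]
   Context: Standardized labeling: the first chain is labeled $1<2<\dots<a_1$, the second $a_1+1<\dots<a_1+a_2$, etc., with no relations between different chains. Braid arrangement: $H_{ij}=\{x\in\mathbb{R}^n:x_i=x_j\}$; $\mathcal{L}$ = intersections of subsets of these hyperplanes (including $V=\mathbb{R}^n$), ordered by reverse inclusion, Möbius function $\mu$. For a poset $P$ on $[n]$, $\mathcal{K}_P=\{x:x_i<x_j\text{ whenever }i<_Pj\}$, $\mathcal{L}^{int}(\mathcal{K}_P)=\{X:X\cap\mathcal{K}_P\ne\emptyset\}$, $c_k(P)=\sum_{X\in\mathcal{L}^{int}(\mathcal{K}_P),\operatorname{codim}X=k}|\mu(V,X)|$, ${\sf Poin}(P,t)=\sum_kc_k(P)t^k$. $\mathcal{L}(P)$ = linear extensions (permutations of $[n]$ in which $i<_Pj$ implies $i$ precedes $j$). A set partition $\pi$ of $[n]$ is $P$-transverse if its blocks are antichains of $P$ and the transitive closure on blocks of ''$B\le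 B'$ if $p\le_P q$ for some $p\in B,q\in B'$'' is antisymmetric; $\mathfrak{S}^{\pitchfork}(P)$ is the set of permutations whose cycle partition is $P$-transverse; $\operatorname{cyc}$ counts cycles. Multiset permutations: a rearrangement of the multiset $\{1^{a_1},\dots,\ell^{a_\ell}\}$ is written in two-line notation with top row $1^{a_1}2^{a_2}\cdots\ell^{a_\ell}$ and the rearrangement as bottom row. The intercalation product $\sigma\intercal\rho$ juxtaposes the column sequences of $\sigma$ and $\rho$ and then stably sorts the columns by top entry (columns with equal top entry keep their relative order). A nonempty multiset permutation is prime if it admits no factorization $\rho\intercal\tau$ with both factors nonempty; by Foata's theorem every multiset permutation is a product of prime ones, uniquely up to swapping adjacent prime factors with disjoint supports, so the number $\operatorname{fc}(\sigma)$ of prime factors is well defined. Each $\lambda\in\mathcal{L}(P_{\overline{a}})$ is identified with the multiset permutation obtained by replacing each entry by the index $j$ of the chain containing it; $\operatorname{fc}(\lambda)$ means $\operatorname{fc}$ of that multiset permutation. *)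

(* Defs.v *)
From HB Require Import structures.
From mathcomp Require Import boolp classical_sets reals.
From mathcomp Require Import all_boot all_order all_algebra all_fingroup.

Set Implicit Arguments.
Unset Strict Implicit.
Unset Printing Implicit Defensive.

Import Order.TTheory GRing.Theory Num.Theory.
Local Open Scope ring_scope.

(* The integers 1, ..., n are the elements 0, ..., n - 1 of 'I_n, and the     *)
(* chains of a composition a = (a_1, ..., a_l) are numbered from 0 to l - 1.  *)
(* A poset on [n] is given by its reflexive order relation P : rel 'I_n.      *)

Section Posets.
Variables (n : nat) (P : rel 'I_n).
Implicit Types (s : {perm 'I_n}) (pi : {set {set 'I_n}}).

Definition strict : rel 'I_n := fun i j => (i != j) && P i j.

(* A permutation s is read as the word s 0, s 1, ..., s (n - 1), so that the  *)
(* position of the letter i is s^-1 i.                                        *)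
Definition linear_extensions : {set {perm 'I_n}} :=
  [set s : {perm 'I_n} |
    let pos := (s^-1)%g : {perm 'I_n} in
    [forall i, forall j, strict i j ==> (pos i < pos j)%N]].

Definition antichain (B : {set 'I_n}) : bool :=
  [forall i in B, forall j in B, ~~ strict i j].

Definition block_rel pi : rel {set 'I_n} := fun B C =>
  [&& B \in pi, C \in pi & [exists i in B, exists j in C, P i j]].

(* connect is the reflexive transitive closure; for reflexive P, block_rel pi *)
(* is already reflexive on nonempty blocks.                                   *)
Definition transverse pi : bool :=
  [&& partition pi [set: 'I_n],
      [forall B in pi, antichain B]
    & [forall B in pi, forall C in pi,
         connect (block_rel pi) B C && connect (block_rel pi) C B ==> (B == C)]].

Definition transverse_perms : {set {perm 'I_n}} :=
  [set s : {perm 'I_n} | transverse (porbits s)].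

End Posets.

Section Mobius.
Variables (T : eqType) (s : seq T) (le : rel T).

Fixpoint mobius_rec (fuel : nat) (x y : T) : int :=
  if fuel is k.+1 then
    if x == y then 1
    else if le x y then
      - \sum_(z <- s | [&& le x z, le z y & z != y]) mobius_rec k x z
    else 0
  else 0.

(* The Moebius function of the finite poset formed by the elements of the     *)
(* duplicate-free list s, ordered by le. The fuel size s is enough, as shown  *)
(* by mobiusxx and mobiusE.                                                   *)
Definition mobius (x y : T) : int := mobius_rec (size s) x y.

Hypotheses (le_refl : reflexive le) (le_anti : antisymmetric le).
Hypothesis le_trans : transitive le.

Lemma count_below_gt0 y : y \in s -> (0 < count (le^~ y) s)%N.
Proof. by move=> ys; rewrite -has_count; apply/hasP; exists y. Qed.

Lemma count_below_lt z y : y \in s -> le z y -> z != y ->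
  (count (le^~ z) s < count (le^~ y) s)%N.
Proof.
move=> ys lezy nzy; case/splitPr: ys => s1 s2; rewrite !count_cat /= le_refl.
have sub r : (count (le^~ z) r <= count (le^~ y) r)%N.
  by apply: sub_count => w /= lewz; apply: le_trans lewz lezy.
have -> : le y z = false.
  by apply: contraNF nzy => leyz; apply/eqP/le_anti; rewrite lezy.
by rewrite add0n add1n addnS ltnS leq_add.
Qed.

Lemma mobius_rec_fuel k1 k2 x y : y \in s ->
  (count (le^~ y) s <= k1)%N -> (count (le^~ y) s <= k2)%N ->
  mobius_rec k1 x y = mobius_rec k2 x y.
Proof.
elim: k1 k2 y => [|k1 IH] [|k2] y ys //=;
  try by have := count_below_gt0 ys; rewrite ?leqn0 lt0n => /negPf->.
move=> le1 le2; case: eqP => // _; case: ifP => // _; congr (- _).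
rewrite big_seq_cond [RHS]big_seq_cond; apply: eq_bigr => z.
case/and4P=> zs _ lezy nzy; have lt := count_below_lt ys lezy nzy.
by apply: IH => //; rewrite -ltnS; apply: leq_trans lt _.
Qed.

Lemma mobiusxx x : x \in s -> mobius x x = 1.
Proof. by rewrite /mobius; case: s => //= y r; rewrite eqxx. Qed.

Lemma mobiusE x y : y \in s -> le x y -> x != y ->
  mobius x y = - \sum_(z <- s | [&& le x z, le z y & z != y]) mobius x z.
Proof.
move=> ys lexy nxy.
have /(_ (size s).+1) E := mobius_rec_fuel x ys (count_size _ _).
rewrite /mobius E ?(leqW (count_size _ _)) //=.
by rewrite (negPf nxy) lexy.
Qed.

End Mobius.

Section Braid.
Variables (R : realType) (n : nat).

Definition coord_diff (i j : 'I_n) (x : 'rV[R]_n) : R^o := x 0 i - x 0 j.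

Lemma coord_diff_is_linear i j : linear (coord_diff i j).
Proof.
move=> c x y; rewrite /coord_diff !mxE scalerBr opprD addrACA.
by [].
Qed.

HB.instance Definition _ i j :=
  GRing.isLinear.Build R 'rV[R]_n R^o _ (coord_diff i j)
    (coord_diff_is_linear i j).

Definition hyperplane (i j : 'I_n) : {vspace 'rV[R]_n} :=
  lker (linfun (coord_diff i j)).

Lemma mem_hyperplane i j x : (x \in hyperplane i j) = (x 0 i == x 0 j).
Proof. by rewrite memv_ker lfunE /= /coord_diff subr_eq0. Qed.

Definition pairs : {set 'I_n * 'I_n} := [set p : 'I_n * 'I_n | (p.1 < p.2)%N].

Definition flats : seq {vspace 'rV[R]_n} :=
  undup [seq (\bigcap_(p in E) hyperplane p.1 p.2)%VS
        | E : {set 'I_n * 'I_n} in powerset pairs].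

Definition flat_le : rel {vspace 'rV[R]_n} := fun X Y => (Y <= X)%VS.

Definition codim (X : {vspace 'rV[R]_n}) : nat := (n - \dim X)%N.

Variable P : rel 'I_n.

Definition cone (x : 'rV[R]_n) : Prop :=
  forall i j, strict P i j -> x 0 i < x 0 j.

Definition interior_flats : seq {vspace 'rV[R]_n} :=
  [seq X : {vspace 'rV[R]_n} <- flats | `[< exists2 x, x \in X & cone x >]].

Definition whitney (k : nat) : nat :=
  (\sum_(X <- interior_flats | codim X == k) `|mobius flats flat_le fullv X|)%N.

Definition Poin : {poly int} := \sum_(k < n.+1) (whitney k)%:R *: 'X^k.

End Braid.

Section MultisetPermutations.
Implicit Types (u v w : seq nat).

(* A multiset permutation is represented by the bottom row w of its two-line  *)
(* notation, the top row being the weakly increasing rearrangement of w.      *)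
Definition columns w : seq (nat * nat) := zip (sort leq w) w.

(* sort is a stable merge sort. *)
Definition intercalation u v : seq nat :=
  unzip2 (sort (fun c d : nat * nat => (c.1 <= d.1)%N) (columns u ++ columns v)).

Definition prime_word w : Prop :=
  w <> [::] /\
  forall u v, w = intercalation u v -> u = [::] \/ v = [::].

Definition prime_factorization (ps : seq (seq nat)) w : Prop :=
  (forall p, p \in ps -> prime_word p) /\ w = foldr intercalation [::] ps.

(* By Foata's theorem, every w has a prime factorization and all of them have *)
(* the same length, so that xget picks that length.                           *)
Definition fc w : nat :=
  xget 0%N (fun k => exists2 ps, prime_factorization ps w & size ps = k).

End MultisetPermutations.

Section Chains.
Variables (a : seq nat) (n : nat).

(* reshape_index a i is the number of the chain containing i, i.e. the r with *)
(* a_0 + ... + a_(r - 1) <= i < a_0 + ... + a_r.                              *)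
Definition chain_poset : rel 'I_n := fun i j =>
  (reshape_index a i == reshape_index a j) && (i <= j)%N.

Lemma chain_poset_refl : reflexive chain_poset.
Proof. by move=> i; rewrite /chain_poset eqxx leqnn. Qed.

Lemma chain_poset_anti : antisymmetric chain_poset.
Proof.
move=> i j /andP[/andP[_ ij] /andP[_ ji]].
by apply/val_inj/eqP; rewrite eqn_leq ij.
Qed.

Lemma chain_poset_trans : transitive chain_poset.
Proof.
move=> j i k /andP[/eqP e1 l1] /andP[/eqP e2 l2].
by rewrite /chain_poset e1 e2 eqxx (leq_trans l1 l2).
Qed.

Definition chain_word (s : {perm 'I_n}) : seq nat :=
  [seq reshape_index a (s i) | i <- enum 'I_n].

End Chains.

Arguments chain_poset : clear implicits.

(* Main.v *)
(* Write r i for the chain of i. Both the linear extensions and the           *)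
(* transverse permutations of a disjoint union of chains are complete systems *)
(* of representatives for the relation "r o s = r o t" on permutations: the   *)
(* linear extension of a class is obtained by stable sorting, its transverse  *)
(* permutation by Foata's algorithm. The bijection sends a linear extension   *)
(* to the transverse permutation of its class.                                *)
(*   Foata's algorithm: send each i to the least element of the chain of w i. *)
(* A minimal invariant set of this map is a cycle C of least elements of      *)
(* chains; C must be a cycle of any transverse t with r o t = w, and it can   *)
(* be removed. In terms of words, removing C is splitting off a left factor   *)
(* of w for the intercalation product, so that a prime word is a single such  *)
(* cycle and the prime factors of w correspond to the cycles of t.            *)
(*   For the Poincare polynomial, let Fix t be the flat of the x such that    *)
(* x o t = x. The sum of the signs of the t such that X <= Fix t vanishes     *)
(* unless X = V, so that mu(V, X) is the sum of the signs of the t such that  *)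
(* Fix t = X; all of these t have as many cycles as the dimension of X.       *)
(* Finally Fix t meets the cone if and only if t is transverse.               *)

Require Import Defs.
From mathcomp Require Import boolp classical_sets reals.
From mathcomp Require Import all_boot all_order all_algebra all_fingroup.

Set Implicit Arguments.
Unset Strict Implicit.
Unset Printing Implicit Defensive.

Import Order.TTheory GRing.Theory Num.Theory.
Local Open Scope nat_scope.

(** * Columns and fibers of multiset permutations *)

(** A word is determined by its fibers, the bottom entries below each top letter, and intercalation
    concatenates fibers. Hence left factors of a word correspond to balanced sets of positions that
    are initial in every chain ([word_split], [word_unsplit]). A permutation is transverse exactly
    when some height is constant on its cycles and strictly increasing along the poset
    ([transverse_height], [height_transverse]).

    The height forces a transverse [t] to follow each cycle of least elements ([sound_agree]).
    Peeling off such cycles shows that every balanced word comes from one and only one such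
    permutation ([sound_exists], [sound_unique]), and that every prime factorization has as many
    factors as [t] has cycles ([size_prime_factorization]), so [fc] counts cycles whichever
    factorization it picks. Linear extensions represent the same classes ([eq_chain_linear],
    [linear_extension_exists]), which yields the bijection.

    For any relation [P], a point of the cone in Fix t is a real-valued height, so Fix t is an
    interior flat iff t is transverse ([mem_interior_flats]). As |mu(V, X)| counts the t with Fix t
    = X ([abs_mobius_fixed_space]), [Poin] enumerates transverse permutations by n - cyc, and the
    bijection turns cyc into [fc]. *)

Definition key_le (c d : nat * nat) := c.1 <= d.1.

Lemma key_le_total : total key_le.
Proof. by move=> c d; apply: leq_total. Qed.

Lemma key_le_trans : transitive key_le.
Proof. by move=> d c e; apply: leq_trans. Qed.

Definition fiber (cs : seq (nat * nat)) (j : nat) : seq nat :=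
  [seq c.2 | c <- cs & c.1 == j].

Lemma fiber_cat cs ds j : fiber (cs ++ ds) j = fiber cs j ++ fiber ds j.
Proof. by rewrite /fiber filter_cat map_cat. Qed.

(** Filtering commutes with a stable sort, and columns sharing a top entry are already sorted for
    [key_le]. *)
Lemma fiber_sort cs j : fiber (sort key_le cs) j = fiber cs j.
Proof.
rewrite /fiber filter_sort; [|exact: key_le_total|exact: key_le_trans].
rewrite sorted_sort //; first exact: key_le_trans.
rewrite (sorted_pairwise key_le_trans); elim: cs => //= c cs IH.
case: eqP => //= cj; rewrite IH andbT; apply/allP => d.
by rewrite mem_filter => /andP[/eqP dj _]; rewrite /key_le cj dj.
Qed.

Lemma fiber_head c cs d ds : sorted key_le (d :: ds) ->
  fiber (c :: cs) =1 fiber (d :: ds) -> d.1 <= c.1.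
Proof.
move=> sd /(_ c.1); rewrite /fiber /= eqxx.
case: eqP => [-> //|_] E.
have : has (fun e => e.1 == c.1) ds by rewrite has_filter; apply: contra_eq_neq E => ->.
case/hasP=> e eds /eqP <-.
by move: sd; rewrite /= (path_sortedE key_le_trans) => /andP[/allP/(_ _ eds)].
Qed.

Lemma eq_from_fiber cs ds :
  sorted key_le cs -> sorted key_le ds -> fiber cs =1 fiber ds -> cs = ds.
Proof.
elim: cs ds => [|c cs IH] [|d ds] // sc sd E.
- by have := E d.1; rewrite /fiber /= eqxx.
- by have := E c.1; rewrite /fiber /= eqxx.
have cd : c.1 = d.1.
  apply/eqP; rewrite eqn_leq; apply/andP.
  by split; [exact: fiber_head sc (fsym E)|exact: fiber_head sd E].
have := E c.1; rewrite /fiber /= -cd eqxx => -[cd2 _].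
have -> : c = d by rewrite [c]surjective_pairing cd cd2 -surjective_pairing.
congr (_ :: _); apply: IH (path_sorted sc) (path_sorted sd) _ => j.
have := E j; rewrite /fiber /= -cd; case: eqP => //= _ [_ ->] //.
Qed.

Lemma columns_sorted w : sorted key_le (columns w).
Proof.
have : sorted leq (sort leq w) by apply: sort_sorted leq_total _.
rewrite -[sort leq w](@unzip1_zip _ _ _ w) ?size_sort //.
by rewrite /unzip1 sorted_map.
Qed.

Lemma unzip2_columns w : unzip2 (columns w) = w.
Proof. by rewrite /columns unzip2_zip // size_sort. Qed.

Lemma unzip1_columns w : unzip1 (columns w) = sort leq w.
Proof. by rewrite /columns unzip1_zip // size_sort. Qed.

Lemma perm_columns w : perm_eq (unzip1 (columns w)) (unzip2 (columns w)).
Proof. by rewrite unzip1_columns unzip2_columns perm_sort. Qed.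

(** Sorted tops that rearrange the bottoms are the sorted bottom row, so the bottom row alone
    recovers the array. *)
Lemma columnsK cs :
  sorted key_le cs -> perm_eq (unzip1 cs) (unzip2 cs) ->
  columns (unzip2 cs) = cs.
Proof.
move=> s12 p12; rewrite /columns; have -> : sort leq (unzip2 cs) = unzip1 cs.
  apply: (sorted_eq leq_trans anti_leq); first exact: sort_sorted leq_total _.
    by rewrite sorted_map.
  by rewrite perm_sort perm_sym.
by rewrite zip_unzip.
Qed.

Lemma columns_intercalation u v :
  columns (intercalation u v) = sort key_le (columns u ++ columns v).
Proof.
rewrite columnsK //; first exact: sort_sorted key_le_total _.
rewrite (permPl (perm_map _ (permEl (perm_sort _ _)))) perm_sym.
rewrite (permPl (perm_map _ (permEl (perm_sort _ _)))) !map_cat perm_sym.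
by rewrite perm_cat ?perm_columns.
Qed.

Lemma fiber_intercalation u v j :
  fiber (columns (intercalation u v)) j
  = fiber (columns u) j ++ fiber (columns v) j.
Proof. by rewrite columns_intercalation fiber_sort fiber_cat. Qed.

Lemma eq_word_from_fiber u v :
  fiber (columns u) =1 fiber (columns v) -> u = v.
Proof.
move=> /(eq_from_fiber (columns_sorted u) (columns_sorted v)) E.
by rewrite -(unzip2_columns u) E unzip2_columns.
Qed.

Lemma intercalationA : associative intercalation.
Proof.
by move=> u v w; apply: eq_word_from_fiber => j; rewrite !fiber_intercalation catA.
Qed.

Lemma intercalation0w w : intercalation [::] w = w.
Proof. by apply: eq_word_from_fiber => j; rewrite fiber_intercalation. Qed.

Lemma intercalationw0 w : intercalation w [::] = w.
Proof.
by apply: eq_word_from_fiber => j; rewrite fiber_intercalation cats0.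
Qed.

Lemma size_intercalation u v : size (intercalation u v) = size u + size v.
Proof.
by rewrite size_map size_sort size_cat !size_zip !size_sort !minnn.
Qed.

Lemma prime_factorization_exists w : exists ps, prime_factorization ps w.
Proof.
have [m] := ubnP (size w); elim: m w => // m IH w /ltnSE szw.
have [pw|npw] := pselect (prime_word w).
  exists [:: w]; split; last by rewrite /= intercalationw0.
  by move=> p; rewrite inE => /eqP->.
have [->|wN] := eqVneq w [::]; first by exists [::].
have [u [v [Dw uN vN]]] :
    exists u v, [/\ w = intercalation u v, u <> [::] & v <> [::]].
  apply: contrapT => nE; apply: npw; split; first exact/eqP.
  move=> u v Dw; case: (eqVneq u [::]) => [|/eqP]; first by left.
  case: (eqVneq v [::]) => [|/eqP]; first by right.
  by move=> vN uN; case: nE; exists u, v.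
have := size_intercalation u v; rewrite -Dw => szE.
have u0 : 0 < size u by case: (u) uN.
have v0 : 0 < size v by case: (v) vN.
have [|ps [psP Du]] := IH u.
  by apply: leq_trans szw; rewrite szE -addn1 leq_add2l.
have [|qs [qsP Dv]] := IH v.
  by apply: leq_trans szw; rewrite szE -add1n leq_add2r.
exists (ps ++ qs); split.
  by move=> p; rewrite mem_cat => /orP[/psP|/qsP].
rewrite Dw Du Dv foldr_cat; elim: (ps) => [|p s IHs] /=.
  by rewrite intercalation0w.
by rewrite -intercalationA IHs.
Qed.

(** * Foata's algorithm *)

Lemma enum_ord_sorted n (S : {set 'I_n}) : sorted (relpre val ltn) (enum S).
Proof.
rewrite [enum _]/enum_mem; apply: sorted_filter => [j i k|]; first exact: ltn_trans.
by rewrite -enumT -sorted_map val_enum_ord iota_ltn_sorted.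
Qed.

Lemma eq_enum_ord n (S : {set 'I_n}) (s : seq 'I_n) :
  sorted (relpre val ltn) s -> s =i S -> s = enum S.
Proof.
move=> s_sorted sE; apply: (@irr_sorted_eq _ (relpre val ltn)) => //.
- by move=> j i k; apply: ltn_trans.
- by move=> i /=; apply: ltnn.
- exact: enum_ord_sorted.
- by move=> i; rewrite mem_enum sE.
Qed.

Lemma perm_enumD (T : finType) (A S : {set T}) :
  A \subset S -> perm_eq (enum S) (enum A ++ enum (S :\: A)).
Proof.
move=> /subsetP sAS; apply: uniq_perm; rewrite ?enum_uniq //.
  rewrite cat_uniq !enum_uniq andbT; apply/hasPn => i.
  by rewrite !mem_enum inE => /andP[].
move=> i; rewrite mem_cat !mem_enum inE.
by case: (boolP (i \in A)) => //= /sAS ->.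
Qed.

Lemma perm_map_stable (T : finType) (S : {set T}) (f : T -> T) :
  {in S &, injective f} -> {in S, forall i, f i \in S} ->
  perm_eq [seq f i | i <- enum S] (enum S).
Proof.
move=> f_inj fS; have uS : uniq [seq f i | i <- enum S].
  by rewrite map_inj_in_uniq ?enum_uniq // => i j; rewrite !mem_enum; apply: f_inj.
apply: uniq_perm; rewrite ?enum_uniq //.
apply: (uniq_min_size uS _ _).2; rewrite ?size_map // => _ /mapP[i iS ->].
by move: iS; rewrite !mem_enum; apply: fS.
Qed.

Definition invariant_set (T : finType) (phi : T -> T) (A : {set T}) :=
  (A != finset.set0) && (phi @: A \subset A).

(** The image of an invariant set is again invariant; thus [phi] permutes a minimal one. *)
Lemma minimal_invariant_im (T : finType) (phi : T -> T) (A : {set T}) :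
  minset (invariant_set phi) A -> phi @: A = A.
Proof.
case/minsetP=> /andP[A0 sA] minA; apply: minA => //.
rewrite /invariant_set imset_eq0 A0 /=; exact: imsetS.
Qed.

Lemma minimal_invariant_porbit (T : finType) (phi : T -> T) (t : {perm T})
    (A : {set T}) (x : T) :
  minset (invariant_set phi) A -> {in A, t =1 phi} -> x \in A -> porbit t x = A.
Proof.
case/minsetP=> /andP[A0 sA] minA tphi xA.
have sub : porbit t x \subset A.
  apply/subsetP => y /porbitP[k ->]; elim: k => [|k IH]; first by rewrite expg0 perm1.
  rewrite expgSr permM tphi //; apply: (subsetP sA); exact: imset_f.
apply: minA => //; apply/andP; split.
  by apply/set0Pn; exists x; apply: porbit_id.
apply/subsetP => _ /imsetP[y yx ->]; rewrite -tphi; last exact: (subsetP sub).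
case/porbitP: yx => k ->; rewrite -permM -expgSr; exact: mem_porbit.
Qed.

Section Foata.
Variables (n : nat) (r w : 'I_n -> nat).
Hypothesis r_mono : forall i j : 'I_n, i <= j -> r i <= r j.
Implicit Types (A D S : {set 'I_n}) (t : {perm 'I_n}) (phi : 'I_n -> 'I_n).

Definition cols S := [seq (r i, w i) | i <- enum S].
Definition word S := [seq w i | i <- enum S].
(** The columns at the positions in [S] form the two-line notation of a multiset permutation. *)
Definition balanced S := perm_eq [seq r i | i <- enum S] (word S).

Definition initial D S := forall i k : 'I_n,
  i \in S -> k \in D -> r i = r k -> i <= k -> i \in D.

Lemma cols_sorted S : sorted key_le (cols S).
Proof.
rewrite sorted_map; apply: sub_sorted (enum_ord_sorted S) => i j /= /ltnW.
exact: r_mono.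
Qed.

Lemma unzip1_cols S : unzip1 (cols S) = [seq r i | i <- enum S].
Proof. by rewrite /unzip1 -map_comp. Qed.

Lemma unzip2_cols S : unzip2 (cols S) = word S.
Proof. by rewrite /unzip2 -map_comp. Qed.

Lemma columns_word S : balanced S -> columns (word S) = cols S.
Proof.
move=> bS; rewrite -unzip2_cols columnsK ?cols_sorted //.
by rewrite unzip1_cols unzip2_cols.
Qed.

Lemma fiber_cols S j :
  fiber (cols S) j = [seq w i | i <- enum [set i in S | r i == j]].
Proof.
rewrite /fiber filter_map -map_comp; congr map; apply: eq_enum_ord.
  apply: sorted_filter (enum_ord_sorted S) => k i l; exact: ltn_trans.
by move=> i; rewrite mem_filter mem_enum !inE /= andbC.
Qed.

Lemma balancedD A S :
  A \subset S -> balanced S -> balanced A -> balanced (S :\: A).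
Proof.
move=> sAS; have pSA := perm_enumD sAS.
rewrite /balanced /word (permPl (perm_map r pSA)) perm_sym.
rewrite (permPl (perm_map w pSA)) !map_cat perm_sym => bS bA.
by move: bS; rewrite (perm_catr _ bA) perm_cat2l.
Qed.

(** In each chain the positions in [D] precede those in [S :\: D], so each fiber of [S] is a
    concatenation. *)
Lemma word_split D S :
  D \subset S -> initial D S -> balanced S -> balanced D ->
  word S = intercalation (word D) (word (S :\: D)).
Proof.
move=> sDS iDS bS bD; have bSD := balancedD sDS bS bD.
apply: eq_word_from_fiber => j; rewrite fiber_intercalation !columns_word //.
rewrite !fiber_cols -map_cat; congr map; apply/esym/eq_enum_ord.
  rewrite sorted_pairwise; last by move=> k i l; apply: ltn_trans.
  rewrite pairwise_cat -!sorted_pairwise; try by move=> k i l; apply: ltn_trans.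
  rewrite !enum_ord_sorted !andbT; apply/allrelP => k i.
  rewrite !mem_enum !inE => /andP[kD /eqP rk] /andP[/andP[iND iS] /eqP ri] /=.
  by rewrite ltnNge; apply: contra iND => /(iDS _ _ iS kD); apply; rewrite ri.
move=> i; rewrite mem_cat !mem_enum !inE.
by case: (boolP (i \in D)) => //= /(subsetP sDS) ->; rewrite orbF.
Qed.

(** In each fiber [u] is a prefix, so [D] takes from chain [j] as many first positions as [u] has
    columns with top [j]. *)
Lemma word_unsplit S u v :
  balanced S -> word S = intercalation u v ->
  exists D, [/\ D \subset S, initial D S, cols D = columns u
              & cols (S :\: D) = columns v].
Proof.
move=> bS DS; pose chain j := enum [set i in S | r i == j].
pose k j := size (fiber (columns u) j).
have chainE j : [seq w i | i <- chain j] =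
    fiber (columns u) j ++ fiber (columns v) j.
  by rewrite -fiber_intercalation -DS columns_word // fiber_cols.
have chain_sorted j :
    sorted (relpre val ltn) (take (k j) (chain j) ++ drop (k j) (chain j)).
  by rewrite cat_take_drop; apply: enum_ord_sorted.
have lt_trans : transitive (relpre (val : 'I_n -> nat) ltn).
  by move=> ? ? ?; apply: ltn_trans.
have mem_chain j i : (i \in take (k j) (chain j)) || (i \in drop (k j) (chain j))
    = (i \in S) && (r i == j).
  by rewrite -mem_cat cat_take_drop mem_enum inE.
have lt_chain j i l : i \in take (k j) (chain j) -> l \in drop (k j) (chain j) ->
    i < l.
  move=> it ld; have := chain_sorted j.
  rewrite sorted_pairwise // pairwise_cat => /andP[/allrelP/(_ i l it ld)] //.
pose D := [set i in S | i \in take (k (r i)) (chain (r i))].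
have fibD j : enum [set i in D | r i == j] = take (k j) (chain j).
  apply/esym/eq_enum_ord.
    have := chain_sorted j; rewrite sorted_pairwise // pairwise_cat.
    by rewrite -!sorted_pairwise // => /and3P[].
  move=> i; rewrite !inE; have := mem_chain j i.
  case: eqP => [->|_]; last by rewrite !andbF => /negbT/norP[/negPf].
  by rewrite !andbT => <-; case: (i \in take _ _) => //=; rewrite andbF.
have fibDC j : enum [set i in S :\: D | r i == j] = drop (k j) (chain j).
  apply/esym/eq_enum_ord.
    have := chain_sorted j; rewrite sorted_pairwise // pairwise_cat.
    by rewrite -!sorted_pairwise // => /and3P[].
  move=> i; rewrite !inE; have := mem_chain j i.
  case: eqP => [->|_]; last by rewrite !andbF => /negbT/norP[_ /negPf].
  rewrite !andbT => <-; case: (boolP (i \in take _ _)) => /= it; last by rewrite andbF.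
  by apply/negP => /(lt_chain _ _ _ it); rewrite ltnn.
have sDS : D \subset S by apply/subsetP => i; rewrite inE => /andP[].
exists D; split => //.
- move=> i l iS; rewrite inE => /andP[lS lt_l] ril le_il; rewrite inE iS /=.
  have := mem_chain (r i) i; rewrite iS eqxx /= => /orP[//|id].
  by move: lt_l; rewrite -ril => /lt_chain/(_ id); rewrite ltnNge le_il.
- apply: eq_from_fiber (cols_sorted _) (columns_sorted _) _ => j.
  by rewrite fiber_cols fibD map_take chainE take_size_cat.
- apply: eq_from_fiber (cols_sorted _) (columns_sorted _) _ => j.
  by rewrite fiber_cols fibDC map_drop chainE drop_size_cat.
Qed.

(** The step map of Foata's algorithm restricted to the positions in [S]. *)
Definition next_min S phi := forall i, i \in S ->
  [/\ phi i \in S, r (phi i) = w i & forall k, k \in S -> r k = w i -> phi i <= k].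

Lemma next_min_exists S : balanced S -> exists phi, next_min S phi.
Proof.
move=> bS; apply: (@fin_all_exists _ (fun _ => 'I_n)
  (fun i j => i \in S -> [/\ j \in S, r j = w i
     & forall k, k \in S -> r k = w i -> j <= k])) => i.
case: (boolP (i \in S)) => [iS|_]; last by exists i.
have /mapP[j jS wj] : w i \in [seq r j | j <- enum S].
  by rewrite (perm_mem bS) map_f // mem_enum.
rewrite mem_enum in jS.
have P0 : (j \in S) && (r j == w i) by rewrite jS wj eqxx.
case: (@arg_minnP _ j (fun j => (j \in S) && (r j == w i)) val P0).
move=> l /andP[lS /eqP rl] lmin; exists l => _; split=> // k kS rk.
by apply: lmin; rewrite kS rk eqxx.
Qed.

Lemma next_min_cycle S phi : next_min S phi -> S != finset.set0 ->
  exists2 A, minset (invariant_set phi) A & A \subset S.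
Proof.
move=> phiS S0; have [|A minA sAS] := @minset_exists _ (invariant_set phi) S.
  rewrite /invariant_set S0; apply/subsetP => _ /imsetP[i iS ->].
  by case: (phiS i iS).
by exists A.
Qed.

(** Balance puts an element of the chain [w i] into [D]; the least element of that chain in [S] is
    at most this one, hence in [D] by initiality. *)
Lemma next_min_initial S D phi :
  D \subset S -> initial D S -> balanced D -> next_min S phi -> next_min D phi.
Proof.
move=> /subsetP sDS iDS /next_min_exists[psi psiD] phiS i iD.
have [psi_iD rpsi _] := psiD i iD.
have [phi_iS rphi phi_min] := phiS i (sDS i iD).
split=> //; last by move=> k /sDS; apply: phi_min.
by apply: (iDS _ (psi i)); rewrite ?rphi //; apply: phi_min; rewrite ?sDS.
Qed.

Section Cycle.
Variables (S A : {set 'I_n}) (phi : 'I_n -> 'I_n).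
Hypotheses (phiS : next_min S phi) (sAS : A \subset S).
Hypothesis minA : minset (invariant_set phi) A.

Let inS i : i \in A -> i \in S. Proof. exact: (subsetP sAS). Qed.

Lemma cycle_closed i : i \in A -> phi i \in A.
Proof. by move=> iA; rewrite -(minimal_invariant_im minA) imset_f. Qed.

Lemma cycle_inj : {in A &, injective phi}.
Proof. by apply/imset_injP; rewrite (minimal_invariant_im minA). Qed.

Lemma cycle_balanced : balanced A.
Proof.
have pA := perm_map_stable cycle_inj cycle_closed.
rewrite /balanced /word -(permPl (perm_map r pA)) -map_comp.
suff /eq_in_map -> : {in enum A, r \o phi =1 w} by [].
by move=> i; rewrite mem_enum => /inS/phiS[].
Qed.

(** Every element of [A] is a value of [phi] on [A], hence least in its chain. *)
Lemma cycle_min (i k : 'I_n) : i \in S -> k \in A -> r i = r k -> k <= i.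
Proof.
move=> iS; rewrite -{1}(minimal_invariant_im minA) => /imsetP[b bA ->].
by case: (phiS (inS bA)) => _ -> bmin rib; apply: bmin.
Qed.

Lemma cycle_initial : initial A S.
Proof.
move=> i k iS kA rik le_ik; suff -> : i = k by [].
by apply/val_inj/eqP; rewrite eqn_leq le_ik cycle_min.
Qed.

End Cycle.

(* The height h witnesses that the cycles of t, as blocks ordered by the      *)
(* chains, form an acyclic relation.                                          *)
Definition sound S t := [/\ {in S, forall i, t i \in S},
  {in S, forall i, r (t i) = w i}
  & exists h : 'I_n -> nat, {in S, forall i, h (t i) = h i} /\
      {in S &, forall i j : 'I_n, r i = r j -> i < j -> h i < h j}].

Lemma sound_balanced S t : sound S t -> balanced S.
Proof.
case=> tS rt _.
have pS := perm_map_stable (in2W (@perm_inj _ t)) tS.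
rewrite /balanced /word -(permPl (perm_map r pS)) -map_comp.
suff /eq_in_map -> : {in enum S, r \o t =1 w} by [].
by move=> i; rewrite mem_enum => /rt.
Qed.

(* Along the cycle, phi i <= t i in the same chain, so h (phi i) <= h i; as   *)
(* phi permutes A, summing over A forces equality everywhere.                 *)
Lemma sound_agree S A t phi : sound S t -> next_min S phi -> A \subset S ->
  minset (invariant_set phi) A -> {in A, t =1 phi}.
Proof.
case=> tS rt [h [ht hS]] phiS sAS minA.
have le_h i : i \in A -> h (phi i) <= h i ?= iff (phi i == t i).
  move=> /(subsetP sAS) iS; have [pS rp pmin] := phiS i iS.
  have := pmin _ (tS _ iS) (rt _ iS); rewrite leq_eqVlt -(ht _ iS).
  case/predU1P=> [/val_inj->|lt_pt]; first by rewrite eqxx; apply: leqif_refl.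
  have lt_h := hS _ _ pS (tS _ iS) (etrans rp (esym (rt _ iS))) lt_pt.
  split; first exact: ltnW.
  by rewrite !ltn_eqF // -val_eqE /= ltn_eqF.
have sum_h : \sum_(i in A) h (phi i) = \sum_(i in A) h i.
  by rewrite -(big_imset h (cycle_inj minA)) (minimal_invariant_im minA).
have [_] := leqif_sum le_h.
by rewrite sum_h eqxx => /esym/forall_inP eqA i iA; rewrite -(eqP (eqA i iA)).
Qed.

Lemma soundD S A t : sound S t -> A \subset S -> t @: A = A -> sound (S :\: A) t.
Proof.
case=> tS rt [h [ht hS]] /subsetP sAS tA; split.
- move=> i; rewrite !inE => /andP[iA iS]; rewrite tS // andbT.
  by apply: contra iA; rewrite -{1}tA (mem_imset _ _ perm_inj).
- by move=> i; rewrite inE => /andP[_ /rt].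
exists h; split=> [i|i j]; first by rewrite inE => /andP[_ /ht].
by rewrite !inE => /andP[_ iS] /andP[_ jS]; apply: hS.
Qed.

Lemma sound_unique S t t' : sound S t -> sound S t' -> {in S, t =1 t'}.
Proof.
have [m] := ubnP #|S|; elim: m S => // m IH S /ltnSE cS sSt sSt'.
have [->|S0] := eqVneq S finset.set0; first by move=> i; rewrite inE.
have [phi phiS] := next_min_exists (sound_balanced sSt).
have [A minA sAS] := next_min_cycle phiS S0.
have At := sound_agree sSt phiS sAS minA.
have At' := sound_agree sSt' phiS sAS minA.
have tA : t @: A = A by rewrite (eq_in_imset At) (minimal_invariant_im minA).
have tA' : t' @: A = A by rewrite (eq_in_imset At') (minimal_invariant_im minA).
have A0 : A != finset.set0 by case/minsetP: minA => /andP[].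
have ltS : #|S :\: A| < m.
  apply: leq_trans cS; rewrite cardsD (setIidPr sAS) ltn_subrL card_gt0 A0 /=.
  by rewrite card_gt0.
move=> i iS; case: (boolP (i \in A)) => [iA|iA]; first by rewrite At ?At'.
by apply: (IH _ ltS (soundD sSt sAS tA) (soundD sSt' sAS tA')); rewrite inE iA.
Qed.

(** Induction on [S]: [phi] on a cycle [A] is glued to a solution on [S :\: A], whose support
    condition keeps it from entering [A]. *)
Lemma sound_exists S : balanced S -> exists2 t, perm_on S t & sound S t.
Proof.
have [m] := ubnP #|S|; elim: m S => // m IH S /ltnSE cS bS.
have [->|S0] := eqVneq S finset.set0.
  exists 1%g; first exact: perm_on1.
  by split=> [i|i|]; rewrite ?inE //; exists (fun=> 0); split=> i; rewrite inE.
have [phi phiS] := next_min_exists bS.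
have [A minA sAS] := next_min_cycle phiS S0.
have A0 : A != finset.set0 by case/minsetP: minA => /andP[].
have ltS : #|S :\: A| < m.
  apply: leq_trans cS; rewrite cardsD (setIidPr sAS) ltn_subrL card_gt0 A0 /=.
  by rewrite card_gt0.
have [t on_t [tS rt [h [ht hS]]]] :=
  IH _ ltS (balancedD sAS bS (cycle_balanced phiS sAS minA)).
have tNA i : i \notin A -> t i \notin A.
  move=> iA; case: (boolP (i \in S)) => iS.
    have : t i \in S :\: A by apply: tS; rewrite inE iA.
    by rewrite inE => /andP[].
  by rewrite (out_perm on_t) // inE (negPf iS) andbF.
pose f i := if i \in A then phi i else t i.
have f_inj : injective f.
  move=> i j; rewrite /f; case: ifPn => iA; case: ifPn => jA.
  - exact: cycle_inj minA _ _ iA jA.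
  - by move=> E; have := tNA j jA; rewrite -E cycle_closed.
  - by move=> E; have := tNA i iA; rewrite E cycle_closed.
  - exact: perm_inj.
exists (perm f_inj).
  apply/subsetP => i; rewrite inE permE /f; case: ifPn => [/(subsetP sAS) //|iA].
  by apply: contraNT => iS; rewrite (out_perm on_t) // inE (negPf iS) andbF.
have phiAS i : i \in A -> [/\ phi i \in S & r (phi i) = w i].
  by move=> /(subsetP sAS)/phiS[].
split=> [i iS|i iS|].
- rewrite permE /f; case: ifPn => [/phiAS[]//|iA].
  have /tS : i \in S :\: A by rewrite inE iA.
  by rewrite inE => /andP[].
- rewrite permE /f; case: ifPn => [/phiAS[]//|iA].
  by apply: rt; rewrite inE iA.
(* The removed cycle goes to the bottom: its elements are least in their chains. *)
exists (fun i => if i \in A then 0 else (h i).+1); split=> [i iS|i j iS jS rij ltij].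
  rewrite permE /f; case: (boolP (i \in A)) => iA; first by rewrite (cycle_closed minA).
  by rewrite (negPf (tNA i iA)) ht // inE iA.
case: (boolP (j \in A)) => jA.
  by have := cycle_min phiS sAS minA iS jA rij; rewrite leqNgt ltij.
by case: ifPn => // iA; rewrite ltnS; apply: hS => //; rewrite inE ?iA ?jA.
Qed.

(** The first factor occupies an initial set [D]. Splitting a minimal cycle off [D] would factor a
    prime word, so [D] is that cycle and, by [sound_agree], a cycle of [t]. The other factors occupy
    [S :\: D]. *)
Lemma size_prime_factorization S t ps : sound S t ->
  prime_factorization ps (word S) -> #|porbit t @: S| = size ps.
Proof.
elim: ps S => [|p ps IH] S sSt [psP].
  rewrite /= => S0; have : size (word S) = 0 by rewrite S0.
  by rewrite size_map -cardE => /eqP; rewrite cards_eq0 => /eqP->; rewrite imset0 cards0.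
rewrite /= => DS; have bS := sound_balanced sSt.
have [D [sDS iDS colD colDC]] := word_unsplit bS DS.
have wD : word D = p by rewrite -unzip2_cols colD unzip2_columns.
have bD : balanced D.
  by rewrite /balanced -unzip1_cols -unzip2_cols colD perm_columns.
have [p0 pprime] := psP p (mem_head _ _).
have D0 : D != finset.set0.
  by apply/eqP => D0; apply: p0; rewrite -wD /word D0 enum_set0.
have [phi phiS] := next_min_exists bS.
have phiD := next_min_initial sDS iDS bD phiS.
have [A minA sAD] := next_min_cycle phiD D0.
have A0 : A != finset.set0 by case/minsetP: minA => /andP[].
have := word_split sAD (cycle_initial phiD sAD minA) bD
  (cycle_balanced phiD sAD minA).
have word0 B : word B = [::] -> B = finset.set0.
  by move=> E; apply/eqP; rewrite -cards_eq0 cardE -(size_map w) -/(word B) E.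
rewrite wD => /pprime[/word0 /eqP|/word0 /eqP]; first by rewrite (negPf A0).
rewrite setD_eq0 => sDA; have {sDA} DA : D = A by apply/eqP; rewrite eqEsubset sDA.
rewrite -{A}DA in minA A0 sAD *.
have tphi := sound_agree sSt phiS sDS minA.
have tD : t @: D = D by rewrite (eq_in_imset tphi) (minimal_invariant_im minA).
have orbitD x : x \in D -> porbit t x = D.
  exact: minimal_invariant_porbit minA tphi.
have [x xD] := set0Pn _ D0.
have -> : porbit t @: S = D |: porbit t @: (S :\: D).
  apply/setP=> B; rewrite !inE; apply/imsetP/predU1P.
    case=> y yS ->; case: (boolP (y \in D)) => [/orbitD|yD]; first by left.
    by right; apply: imset_f; rewrite inE yD.
  case=> [->|/imsetP[y]]; first by exists x; [exact: (subsetP sDS)|rewrite orbitD].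
  by rewrite inE => /andP[_ yS] ->; exists y.
rewrite cardsU1 (IH _ (soundD sSt sDS tD)); last first.
  split=> [q qps|]; first by apply: psP; rewrite inE qps orbT.
  by rewrite -unzip2_cols colDC unzip2_columns.
case: imsetP => // -[y]; rewrite inE => /andP[yD _] Dy.
by rewrite Dy porbit_id in yD.
Qed.

End Foata.

(** * Transverse permutations and height functions *)

Lemma partition_porbits (T : finType) (s : {perm T}) :
  partition (porbits s) [set: T].
Proof.
apply/and3P; split.
- rewrite eqEsubset finset.subsetT; apply/subsetP => x _.
  by apply/bigcupP; exists (porbit s x); [apply: imset_f|apply: porbit_id].
- apply/trivIsetP => _ _ /imsetP[x _ ->] /imsetP[y _ ->]; apply: contraR.
  rewrite -setI_eq0 => /set0Pn[z]; rewrite inE => /andP[].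
  by rewrite -!eq_porbit_mem => /eqP-> /eqP->.
- by apply/imsetP => -[x _] /esym x0; have := porbit_id s x; rewrite x0 inE.
Qed.

Lemma porbit_step (T : finType) (s : {perm T}) (x : T) : porbit s (s x) = porbit s x.
Proof. by have := porbit_perm s 1 x; rewrite expg1. Qed.

Lemma perm_map_stableT (T : finType) (s : {perm T}) :
  perm_eq [seq s i | i <- enum [set: T]] (enum [set: T]).
Proof. by apply: perm_map_stable => [|i _]; [apply: in2W perm_inj|rewrite !inE]. Qed.

Section Height.
Variables (n : nat) (P : rel 'I_n) (s : {perm 'I_n}).

Lemma transverse_height : s \in transverse_perms P ->
  exists h : 'I_n -> nat, (forall i, h (s i) = h i) /\
    (forall i j, strict P i j -> h i < h j).
Proof.
rewrite inE => /and3P[_ /forall_inP anti /forall_inP acyclic].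
(* The height of [i] counts the blocks below its cycle; antisymmetry makes it strictly
   increasing. *)
exists (fun i => #|[set B | connect (block_rel P (porbits s)) B (porbit s i)]|).
split=> [i|i j sij]; first by rewrite porbit_step.
have iB : porbit s i \in porbits s by apply: imset_f.
have jB : porbit s j \in porbits s by apply: imset_f.
have cij : connect (block_rel P (porbits s)) (porbit s i) (porbit s j).
  apply: connect1; rewrite /block_rel iB jB; apply/exists_inP; exists i.
    exact: porbit_id.
  by apply/exists_inP; exists j; [apply: porbit_id|case/andP: sij].
have Nij : porbit s i != porbit s j.
  apply: contraTneq sij => Eij; have /forall_inP/(_ i (porbit_id s i)) := anti _ iB.
  by move=> /forall_inP/(_ j); apply; rewrite Eij porbit_id.
apply: proper_card; apply/properP; split.
  by apply/subsetP => B; rewrite !inE => /connect_trans; apply.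
exists (porbit s j); rewrite !inE ?connect0 //.
apply: contra Nij => cji; have /forall_inP/(_ _ jB)/implyP := acyclic _ iB.
by rewrite cij; apply.
Qed.

(** The codomain is general in order to cover both natural heights and the coordinates of a point of
    the cone. *)
Lemma height_transverse (d : Order.disp_t) (T : orderType d) (h : 'I_n -> T) :
  (forall i, h (s i) = h i) ->
  (forall i j, strict P i j -> (h i < h j)%O) -> s \in transverse_perms P.
Proof.
move=> hs hP; have h_porbit i j : j \in porbit s i -> h j = h i.
  case/porbitP=> k ->; elim: k => [|k IH]; first by rewrite expg0 perm1.
  by rewrite expgSr permM hs.
have h_block B i j : B \in porbits s -> i \in B -> j \in B -> h i = h j.
  by case/imsetP=> x _ -> /h_porbit-> /h_porbit->.
have hlt i j : P i j -> i = j \/ (h i < h j)%O.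
  by case: (eqVneq i j) => [|ij] Pij; [left|right; apply: hP; rewrite /strict ij].
rewrite inE; apply/and3P; split; first exact: partition_porbits.
  apply/forall_inP => B BP; apply/forall_inP => i iB; apply/forall_inP => j jB.
  by apply/negP => /hP; rewrite (h_block B i j) // ltxx.
pose e := block_rel P (porbits s).
(* A step between distinct elements raises the height strictly, and a step at a common element stays
   in the same cycle. *)
have path_le B p i j : path e B p -> i \in B -> j \in last B p -> B \in porbits s ->
    (h i <= h j)%O /\ (h j = h i -> last B p = B).
  elim: p B i => [|C p IH] B i /= eBp iB jl BP.
    by rewrite (h_block B i j).
  case/andP: eBp => /and3P[_ CP /exists_inP[k kB /exists_inP[l lC Pkl]]] eCp.
  have [le_lj eq_lj] := IH C l eCp lC jl CP.
  rewrite (h_block B i k) //; have [kl|lt_kl] := hlt _ _ Pkl; last first.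
    have lt_kj := Order.POrderTheory.lt_le_trans lt_kl le_lj.
    by split; [apply: Order.POrderTheory.ltW | move=> E; rewrite E ltxx in lt_kj].
  rewrite -kl in lC le_lj eq_lj.
  have BC : C = B.
    case/imsetP: BP kB => x _ -> kx; case/imsetP: CP lC => y _ -> ky.
    by move: kx ky; rewrite -!eq_porbit_mem => /eqP-> /eqP->.
  by split=> // /eq_lj ->.
apply/forall_inP => B BP; apply/forall_inP => C CP; apply/implyP.
case/andP=> /connectP[p eBp DC] /connectP[q eCq DB].
have [i iB] : exists i, i \in B.
  by case/imsetP: (BP) => x _ ->; exists x; apply: porbit_id.
have [j jC] : exists j, j \in C.
  by case/imsetP: (CP) => x _ ->; exists x; apply: porbit_id.
rewrite DC in jC; rewrite DB in iB.
have [|le1 eq1] := path_le B p i j eBp _ jC BP; first by rewrite DB.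
have [|le2 _] := path_le C q j i eCq _ iB CP; first by rewrite DC.
by rewrite eq_sym DC eq1 //; apply/Order.POrderTheory.le_anti; rewrite le1 le2.
Qed.

End Height.

(** * Class representatives for disjoint unions of chains *)

Section Chains.
Variables (a : seq nat) (n : nat).
Implicit Types s t : {perm 'I_n}.
Let r (i : 'I_n) := reshape_index a i.

Lemma reshape_index_mono (i j : 'I_n) : i <= j -> r i <= r j.
Proof. by rewrite (reshape_leq a) => /orP[/ltnW|/andP[/eqP E _]] //; rewrite /r E. Qed.

Lemma strict_chain i j : strict (chain_poset a n) i j = (r i == r j) && (i < j).
Proof.
by rewrite /strict /chain_poset andbCA ltn_neqAle.
Qed.

Lemma transverse_sound t : t \in transverse_perms (chain_poset a n) ->
  sound r (fun i => r (t i)) finset.setT t.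
Proof.
case/transverse_height => h [ht hP]; split=> //; exists h; split=> // i j _ _ rij ltij.
by apply: hP; rewrite strict_chain rij eqxx.
Qed.

Lemma sound_transverse w t : sound r w finset.setT t ->
  t \in transverse_perms (chain_poset a n).
Proof.
case=> _ _ [h [ht hP]]; apply: (height_transverse (h := h)) => [i|i j].
  exact: ht.
by rewrite strict_chain => /andP[/eqP rij]; apply: hP.
Qed.

Lemma chain_wordE s : chain_word a s = word (fun i => r (s i)) finset.setT.
Proof. by rewrite /chain_word /word enum_setT enumT. Qed.

Lemma eq_chain_transverse t t' :
  t \in transverse_perms (chain_poset a n) ->
  t' \in transverse_perms (chain_poset a n) ->
  (forall i, r (t i) = r (t' i)) -> t = t'.
Proof.
move=> /transverse_sound tT /transverse_sound tT' /funext rt.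
rewrite -rt in tT'; apply/permP => i.
exact: (sound_unique tT tT' (finset.in_setT i)).
Qed.

Lemma transverse_exists s : exists2 t,
  t \in transverse_perms (chain_poset a n) & forall i, r (t i) = r (s i).
Proof.
have bT : balanced r (fun i => r (s i)) finset.setT.
  rewrite /balanced perm_sym /word (map_comp r s).
  exact/perm_map/perm_map_stableT.
have [t _ tT] := sound_exists bT.
by exists t; [apply: sound_transverse tT | case: tT => _ rt _ i; apply: rt].
Qed.

Lemma fc_transverse s t : t \in transverse_perms (chain_poset a n) ->
  (forall i, r (t i) = r (s i)) -> fc (chain_word a s) = #|porbits t|.
Proof.
move=> /transverse_sound tT /funext rt; rewrite rt in tT.
have [ps psP] := prime_factorization_exists (chain_word a s).
have : exists k, (fun k => exists2 ps, prime_factorization ps (chain_word a s)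
                                     & size ps = k) k by exists (size ps), ps.
rewrite /fc => /(@xgetPex _ 0)[qs qsP <-].
rewrite -(size_prime_factorization (@reshape_index_mono) tT) -?chain_wordE //.
congr #|pred_of_set _|; apply/setP => B.
by apply/imsetP/imsetP => -[x _ ->]; exists x.
Qed.

(** A linear extension lists each chain in increasing order, so the letter at position [i] has as
    rank in its chain the number of earlier letters of that chain, which the word determines. *)
Lemma eq_chain_linear s s' :
  s \in linear_extensions (chain_poset a n) ->
  s' \in linear_extensions (chain_poset a n) ->
  (forall i, r (s i) = r (s' i)) -> s = s'.
Proof.
pose rank (x : 'I_n) := #|[set y | (r y == r x) && (y < x)]|.
have rankE t i : t \in linear_extensions (chain_poset a n) ->
    rank (t i) = #|[set k | (r (t k) == r (t i)) && (k < i)]|.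
  rewrite inE => /forallP/= tL.
  rewrite -[RHS](card_imset _ (@perm_inj _ t)); apply: eq_card => y.
  rewrite -(permKV t y) (mem_imset _ _ perm_inj) !inE.
  move: ((t^-1)%g y) => k; case: eqP => //= rti.
  have mono (p q : 'I_n) : r (t p) = r (t q) -> t p < t q -> p < q.
    move=> rpq lt_pq; have /forallP/(_ (t q))/implyP := tL (t p).
    by rewrite strict_chain rpq eqxx lt_pq !permK => /(_ isT).
  apply/idP/idP; first exact: mono.
  case: (ltngtP (t k) (t i)) => // [|/val_inj/perm_inj ->]; last by rewrite ltnn.
  by move=> /(mono _ _ (esym rti))/ltnW; rewrite leqNgt => /negPf->.
have rank_inj x y : r x = r y -> rank x = rank y -> x = y.
  have lt_rank (u v : 'I_n) : r u = r v -> u < v -> rank u < rank v.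
    move=> ruv ltuv; apply: proper_card; apply/properP; split.
      by apply/subsetP => z; rewrite !inE ruv => /andP[-> /ltn_trans->].
    by exists u; rewrite !inE ?ltnn ?andbF // ruv eqxx.
  move=> rxy rk; case: (ltngtP x y) => [lt_xy|lt_yx|/val_inj //].
    by case/eqP: (negbT (ltn_eqF (lt_rank _ _ rxy lt_xy))).
  by case/eqP: (negbT (gtn_eqF (lt_rank _ _ (esym rxy) lt_yx))).
move=> sL s'L rs; apply/permP => i; apply: rank_inj => //.
by rewrite !rankE //; apply: eq_card => k; rewrite !inE !rs.
Qed.

Lemma linear_extension_exists t : exists2 s,
  s \in linear_extensions (chain_poset a n) & forall i, r (s i) = r (t i).
Proof.
pose le (i j : 'I_n) := r (t i) <= r (t j).
pose e := sort le (enum 'I_n).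
have enum_sorted : sorted (relpre val ltn) (enum 'I_n).
  by have := enum_ord_sorted (finset.setT : {set 'I_n}); rewrite enum_setT -enumT.
have le_total : total le by move=> i j; apply: leq_total.
have e_sorted : sorted [rel x y | le x y && (le y x ==> (x < y))] e.
  by apply: sort_stable le_total _ _ enum_sorted => j i k; apply: ltn_trans.
have size_e : size e = n by rewrite size_sort size_enum_ord.
have e_uniq : uniq e by rewrite sort_uniq enum_uniq.
(* [f x] is the position that will carry the letter [x], so the linear extension is the inverse of
   [f]. *)
pose f (i : 'I_n) := nth i e i.
have f_inj : injective f.
  move=> i j; rewrite /f (set_nth_default i j) ?size_e // => /eqP.
  by rewrite nth_uniq ?size_e // => /eqP/val_inj.
have rf i : r (t (f i)) = r i.
  (* Both sides are sorted rearrangements of the same multiset of chain indices. *)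
  have E : [seq r (t x) | x <- e] = [seq r x | x <- enum 'I_n].
    apply: (sorted_eq leq_trans anti_leq).
    - rewrite sorted_map; apply: sort_sorted le_total _.
    - rewrite sorted_map; apply: sub_sorted enum_sorted => x y /ltnW.
      exact: reshape_index_mono.
    - rewrite (map_comp r t) (permPl (perm_map r (perm_map t (permEl (perm_sort _ _))))).
      apply: perm_map; have := perm_map_stableT t.
      by rewrite enum_setT -enumT.
  rewrite /f -(nth_map i (r i) (fun x => r (t x))) ?size_e // E.
  by rewrite (nth_map i (r i) r) ?size_enum_ord // nth_ord_enum.
exists (perm f_inj)^-1%g => [|i]; last by rewrite -{2}(permKV (perm f_inj) i) permE rf.
rewrite inE invgK; apply/forallP => x; apply/forallP => y; apply/implyP.
rewrite strict_chain !permE => /andP[/eqP rxy ltxy].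
have le_tr : transitive [rel x y | le x y && (le y x ==> (x < y))].
  move=> j i k /= /andP[lij ij] /andP[ljk jk]; rewrite /le (leq_trans lij ljk) /=.
  apply/implyP => lki; apply: (@ltn_trans j).
    by apply: (implyP ij); apply: leq_trans lki.
  by apply: (implyP jk); apply: leq_trans lij.
have := sorted_ltn_nth le_tr x e_sorted; move=> /(_ x y); rewrite !inE !size_e.
move=> /(_ (ltn_ord _) (ltn_ord _) ltxy) /andP[_ /implyP].
rewrite (set_nth_default y x) ?size_e // /le -/(f y) -[nth x e x]/(f x) !rf rxy.
by apply.
Qed.

End Chains.

(** * The bijection from linear extensions to transverse permutations *)

Section Bijection.
Variables (a : seq nat) (n : nat).

(** The transverse permutation in the class of [s]; [transverse_exists] excludes the default
    value. *)
Definition foata_map (s : {perm 'I_n}) : {perm 'I_n} :=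
  odflt s [pick t in transverse_perms (chain_poset a n) |
    [forall i : 'I_n, reshape_index a (t i) == reshape_index a (s i)]].

Lemma foata_mapP s : foata_map s \in transverse_perms (chain_poset a n) /\
  forall i, reshape_index a (foata_map s i) = reshape_index a (s i).
Proof.
rewrite /foata_map; case: pickP => [t /andP[tT /forallP rt]|/= noT].
  by split=> // i; apply/eqP.
have [t tT rt] := transverse_exists a s.
by case/negP: (negbT (noT t)); rewrite tT; apply/forallP => i; rewrite rt.
Qed.

Lemma foata_map_inj :
  {in linear_extensions (chain_poset a n) &, injective foata_map}.
Proof.
move=> s s' sL s'L E; apply: (eq_chain_linear sL s'L) => i.
by rewrite -(foata_mapP s).2 E (foata_mapP s').2.
Qed.

Lemma foata_map_im : foata_map @: linear_extensions (chain_poset a n)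
  = transverse_perms (chain_poset a n).
Proof.
apply/setP => t; apply/imsetP/idP => [[s _ ->]|tT]; first by case: (foata_mapP s).
have [s sL rs] := linear_extension_exists a t; exists s => //.
have [sT fs] := foata_mapP s.
by apply: (eq_chain_transverse tT sT) => i; rewrite fs rs.
Qed.

Lemma card_porbits_foata_map s :
  #|porbits (foata_map s)| = fc (chain_word a s).
Proof. by case: (foata_mapP s) => sT fs; rewrite (fc_transverse sT fs). Qed.

End Bijection.

(** * Fixed spaces in the braid arrangement *)

Local Open Scope ring_scope.

Lemma sum_seq_eq (V : nmodType) (T : eqType) (s : seq T) (Q : pred T) (y : T)
    (F : T -> V) : uniq s ->
  \sum_(z <- s | Q z && (y == z)) F z = if (y \in s) && Q y then F y else 0.
Proof.
elim: s => [|z s IH] /=; first by rewrite big_nil.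
case/andP=> zs us; rewrite big_cons inE IH //.
case: (eqVneq y z) => [->|_]; last by rewrite andbF.
by rewrite andbT (negPf zs) /=; case: (Q z); rewrite ?addr0.
Qed.

Section FixedSpaces.
Variables (R : realType) (n : nat).
Implicit Types (t : {perm 'I_n}) (x : 'rV[R]_n) (X : {vspace 'rV[R]_n}).

Lemma mem_cap_hyperplanes (E : {set 'I_n * 'I_n}) x :
  reflect (forall p, p \in E -> x 0 p.1 = x 0 p.2)
    (x \in (\bigcap_(p in E) hyperplane R p.1 p.2)%VS).
Proof.
rewrite memvE; apply: (iffP subv_bigcapP) => Ex p /Ex.
  by rewrite -memvE mem_hyperplane => /eqP.
by rewrite -memvE mem_hyperplane => ->.
Qed.

(** The space Fix t, written as an intersection of hyperplanes so that it is visibly a flat. *)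
Definition fixed_space t : {vspace 'rV[R]_n} :=
  (\bigcap_(p in [set p : 'I_n * 'I_n | (p.1 < p.2)%N && (p.2 \in porbit t p.1)])
     hyperplane R p.1 p.2)%VS.

Lemma fixed_spaceP t x :
  reflect (forall i, x 0 (t i) = x 0 i) (x \in fixed_space t).
Proof.
apply: (iffP (mem_cap_hyperplanes _ _)) => [Ex i|xt [i j]].
  case: (ltngtP i (t i)) => [lt_i|lt_i|/val_inj<- //].
    by apply/esym/(Ex (i, t i)); rewrite inE lt_i -(porbit_step t i) porbit_id.
  by apply: (Ex (t i, i)); rewrite inE lt_i porbit_step porbit_id.
rewrite inE /= => /andP[_ /porbitP[k ->]].
by elim: k => [|k IH]; rewrite ?expg0 ?perm1 // expgSr permM xt.
Qed.

Lemma fixed_space_flat t : fixed_space t \in flats R n.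
Proof.
rewrite mem_undup; apply/imageP.
exists [set p : 'I_n * 'I_n | (p.1 < p.2)%N && (p.2 \in porbit t p.1)] => //.
by rewrite powersetE; apply/subsetP => p; rewrite !inE => /andP[].
Qed.

Lemma sub_fixed_spaceP X t :
  reflect (forall x, x \in X -> forall i, x 0 (t i) = x 0 i)
    (X <= fixed_space t)%VS.
Proof.
by apply: (iffP subvP) => XF x /XF /fixed_spaceP.
Qed.

(** Fixed vectors are the functions on the set of cycles, pulled back to the coordinates by the
    matrix [M]. *)
Lemma dim_fixed_space t : \dim (fixed_space t) = #|porbits t|.
Proof.
have inP i : porbit t i \in porbits t by apply: imset_f.
pose rk i := enum_rank_in (inP i) (porbit t i).
have rkE i : enum_val (rk i) = porbit t i by rewrite enum_rankK_in.
have [g gK] : exists g : 'I_#|porbits t| -> 'I_n, forall k, rk (g k) = k.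
  apply: (@fin_all_exists _ (fun=> 'I_n) (fun k i => rk i = k)) => k.
  have /imsetP[i _ Ei] := enum_valP k; exists i; apply: enum_val_inj.
  by rewrite rkE Ei.
pose M : 'M[R]_(#|porbits t|, n) := \matrix_(k, i) (k == rk i)%:R.
have ME (y : 'rV_#|porbits t|) i : (y *m M) 0 i = y 0 (rk i).
  rewrite mxE (bigD1 (rk i)) //= big1 => [|k /negPf nk]; rewrite mxE ?eqxx ?nk.
    by rewrite mulr1 addr0.
  by rewrite mulr0.
have -> : fixed_space t = limg (linfun (mulmxr M)).
  apply/vspaceP => x; apply/fixed_spaceP/memv_imgP => [xt|[y _ ->] i]; last first.
    rewrite lfunE /= !ME; congr (y 0 _); apply: enum_val_inj.
    by rewrite !rkE porbit_step.
  exists (\row_k x 0 (g k)); first exact: memvf.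
  apply/rowP => i; rewrite lfunE /= ME mxE.
  have : i \in porbit t (g (rk i)) by rewrite -rkE gK rkE porbit_id.
  move: (g (rk i)) => j /porbitP[k ->].
  elim: k => [|k IH]; first by rewrite expg0 perm1.
  by rewrite expgSr permM xt.
rewrite limg_dim_eq; first by rewrite dimvf dim_matrix mul1r.
apply/eqP; rewrite capfv; apply/lker0P => y z; rewrite !lfunE /= => Eyz.
by apply/rowP => k; rewrite -(gK k) -!ME Eyz.
Qed.

Lemma fixed_space1 t : (fixed_space t == fullv) = (t == 1%g).
Proof.
apply/eqP/eqP => [Ft|->]; last first.
  by apply/vspaceP => x; rewrite memvf; apply/fixed_spaceP => i; rewrite perm1.
apply/permP => i; rewrite perm1; apply/eqP.
have /fixed_spaceP/(_ i) : delta_mx 0 i \in fixed_space t by rewrite Ft memvf.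
by rewrite !mxE !eqxx /=; case: eqP => // _ /eqP; rewrite eq_sym oner_eq0.
Qed.

Lemma flat_identified_pair X : X \in flats R n -> X != fullv ->
  exists i j : 'I_n, i != j /\ forall x, x \in X -> x 0 i = x 0 j.
Proof.
rewrite mem_undup => /imageP[E]; rewrite powersetE => /subsetP sE -> XN.
have [E0|[[i j] ijE]] := set_0Vmem E.
  by case/eqP: XN; rewrite E0 big_set0.
exists i, j; split; last by move=> x /mem_cap_hyperplanes/(_ _ ijE).
by have := sE _ ijE; rewrite inE /= => /ltn_eqF; rewrite -val_eqE /= => ->.
Qed.

(* Multiplication by a transposition fixing X pointwise is a sign-reversing   *)
(* involution of the pointwise stabilizer of X.                               *)
Lemma sum_sign_stabilizer X : X \in flats R n -> X != fullv ->
  \sum_(t : {perm 'I_n} | (X <= fixed_space t)%VS) (-1) ^+ t = 0 :> int.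
Proof.
move=> Xflat /(flat_identified_pair Xflat)[i [j [ij Xij]]].
have tperm_fix x k : x \in X -> x 0 (tperm i j k) = x 0 k.
  by move=> /Xij E; case: tpermP => // ->.
have stab t : (X <= fixed_space t)%VS -> (X <= fixed_space (tperm i j * t)%g)%VS.
  move=> /sub_fixed_spaceP Xt; apply/sub_fixed_spaceP => x xX k.
  by rewrite permM Xt // tperm_fix.
apply/eqP; rewrite -eqNr -sumrN (reindex_inj (mulgI (tperm i j))).
apply/eqP/eq_big => t; last by rewrite odd_mul_tperm ij signrN opprK.
apply/idP/idP; last exact: stab.
by move/stab; rewrite mulgA tperm2 mul1g.
Qed.

(** Induction on codimension: the recursion for mu sums the signs of the t whose Fix t strictly
    contains X, each counted at its own flat, and [sum_sign_stabilizer] makes this the opposite of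
    the sum over Fix t = X. *)
Lemma mobius_fixed_space X : X \in flats R n ->
  mobius (flats R n) (@flat_le R n) fullv X
  = \sum_(t : {perm 'I_n} | fixed_space t == X) (-1) ^+ t.
Proof.
have refl : reflexive (@flat_le R n) by move=> Y; apply: subvv.
have anti : antisymmetric (@flat_le R n).
  by move=> Y Z; rewrite /flat_le => /subv_anti ->.
have trans : transitive (@flat_le R n).
  by move=> Y Z W YZ WY; apply: subv_trans WY YZ.
have [m] := ubnP (n - \dim X)%N; elim: m X => // m IH X /ltnSE leX Xflat.
have [XE|XN] := eqVneq X fullv.
  rewrite XE mobiusxx -?XE // (big_pred1 1%g) ?odd_perm1 // => t.
  by rewrite XE fixed_space1.
rewrite (mobiusE refl anti trans) ?(eq_sym fullv) //; last exact: subvf.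
rewrite big_seq_cond; under eq_bigr => Z.
  case/and4P=> Zflat _ leXZ ZX; rewrite IH //; last first.
    have dimZ : (\dim Z <= n)%N.
      by have := dimvS (subvf Z); rewrite dimvf dim_matrix mul1r.
    have ltXZ : (\dim X < \dim Z)%N.
      have {}leXZ : (X <= Z)%VS := leXZ.
      by rewrite ltnNge; apply: contra ZX => leZX; rewrite eq_sym eqEdim leXZ.
    exact: leq_trans (ltn_sub2l (leq_trans ltXZ dimZ) ltXZ) leX.
  over.
rewrite -big_seq_cond (exchange_big_dep predT) //=.
under eq_bigr => t _ do rewrite sum_seq_eq ?undup_uniq // fixed_space_flat.
rewrite -big_mkcond /=; have := sum_sign_stabilizer Xflat XN.
rewrite (bigID (fun t => fixed_space t == X)) /= => /eqP; rewrite addr_eq0.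
move=> /eqP; under eq_bigl => t.
  rewrite (_ : _ && _ = (fixed_space t == X)); last first.
    by case: eqP => [->|_]; rewrite ?subvv ?andbF.
  over.
by move=> ->; congr (- _); apply: eq_bigl => t; rewrite /flat_le subvf.
Qed.

(** All t with Fix t = X have \dim X cycles, hence the same sign, so nothing cancels. *)
Lemma abs_mobius_fixed_space X : X \in flats R n ->
  `|mobius (flats R n) (@flat_le R n) fullv X|%N
  = #|[set t | fixed_space t == X]|.
Proof.
move=> Xflat; rewrite mobius_fixed_space //.
rewrite (eq_bigr (fun=> (-1) ^+ (odd n (+) odd (\dim X)))); last first.
  by move=> t /eqP <-; rewrite /odd_perm card_ord dim_fixed_space.
rewrite sumr_const -mulr_natr abszMsign natz absz_nat.
by apply: eq_card => t; rewrite !inE.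
Qed.

(** * The Poincare polynomial of a cone as a sum over transverse permutations *)

Section Poincare.
Variable P : rel 'I_n.

Lemma mem_interior_flats t :
  (fixed_space t \in interior_flats R P) = (t \in transverse_perms P).
Proof.
rewrite mem_filter fixed_space_flat andbT; apply/asboolP/idP.
  case=> x /fixed_spaceP xt xP; exact: (height_transverse xt).
case/transverse_height => h [ht hP]; exists (\row_i (h i)%:R).
  by apply/fixed_spaceP => i; rewrite !mxE ht.
by move=> i j /hP; rewrite !mxE ltr_nat.
Qed.

(** Double counting of the pairs (X, t) with Fix t = X. *)
Lemma whitney_transverse k :
  whitney R P k = #|[set t in transverse_perms P | (n - #|porbits t|)%N == k]|.
Proof.
rewrite /whitney big_seq_cond; under eq_bigr => X /andP[].
  rewrite mem_filter => /andP[_ Xflat] _; rewrite abs_mobius_fixed_space //.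
  rewrite -sum1_card.
  over.
rewrite -big_seq_cond (exchange_big_dep predT) //=.
rewrite -sum1_card [RHS]big_mkcond /=; apply: eq_bigr => t _.
under eq_bigl => X do rewrite inE.
rewrite (@sum_seq_eq nat _ _ (fun X => codim X == k)) ?filter_uniq ?undup_uniq //.
by rewrite mem_interior_flats [in RHS]inE /codim dim_fixed_space.
Qed.

Lemma Poin_transverse :
  Poin R P = \sum_(t in transverse_perms P) 'X^(n - #|porbits t|).
Proof.
have codimE t (k : 'I_n.+1) :
    (inord (n - #|porbits t|) == k) = (n - #|porbits t| == k)%N.
  by rewrite -(inj_eq val_inj) /= inordK // ltnS leq_subr.
rewrite (partition_big (fun t => inord (n - #|porbits t|) : 'I_n.+1) predT) //=.
apply: eq_bigr => k _; rewrite whitney_transverse.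
rewrite (eq_bigr (fun=> 'X^k)) => [|t /andP[_]]; last first.
  by rewrite codimE => /eqP->.
rewrite sumr_const scaler_nat; congr (_ *+ _); apply: eq_card => t.
by rewrite [in LHS]inE -codimE.
Qed.

End Poincare.

End FixedSpaces.

Theorem theorem1p3 (R : realType) (n : nat) (a : seq nat) (sum_a : sumn a = n) :
  (exists f : {perm 'I_n} -> {perm 'I_n},
     [/\ {in linear_extensions (chain_poset a n) &, injective f},
         f @: linear_extensions (chain_poset a n)
           = transverse_perms (chain_poset a n)
       & {in linear_extensions (chain_poset a n), forall s,
           #|porbits (f s)| = fc (chain_word a s)}])
  /\ Poin R (chain_poset a n)
     = \sum_(s in linear_extensions (chain_poset a n))
          'X^(n - fc (chain_word a s)).
Proof.
split.
  exists (@foata_map a n); split; [exact: foata_map_inj | exact: foata_map_im |].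
  by move=> s _; apply: card_porbits_foata_map.
rewrite Poin_transverse -foata_map_im (big_imset _ (@foata_map_inj a n)).
by apply: eq_bigr => s _; rewrite card_porbits_foata_map.
Qed.
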